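(* Let $\beta: I\to M\subset G^3$ be an arbitrary unit-speed curve on a surface $M$ in the Galilean space $G^3$, with Darboux frame $\{\mathbf T,\mathbf Q,\mathbf n\}$, geodesic curvature $\kappa_g$, normal curvature $\kappa_n$ and geodesic torsion $\tau_g$. Then the position vector of $\beta$ with respect to the Darboux frame is $$\begin{aligned}\beta(x)=(x+c_1)\mathbf T&+\Big\{-\frac{(x+c_1)\kappa_n(x)}{\tau_g(x)}+\Big(c_2-\int f(x)\tau_g(x)\sin[t(x)]\,dx\Big)\sin[t(x)]\\&\quad-\Big(c_3+\int f(x)\tau_g(x)\cos[t(x)]\,dx\Big)\cos[t(x)]\Big\}\mathbf Q\\&+\Big\{\Big(c_2-\int f(x)\tau_g(x)\sin[t(x)]\,dx\Big)\cos[t(x)]\\&\quad+\Big(c_3+\int f(x)\tau_g(x)\cos[t(x)]\,dx\Big)\sin[t(x)]\Big\}\mathbf n,\end{aligned}$$ where $c_1,c_2,c_3$ are real constants (of integration), $\lambda_1(x)=x+c_1$, $$f(x)=\frac{\lambda_1(x)\kappa_g(x)}{\tau_g(x)}-\left(\frac{\lambda_1(x)\kappa_n(x)}{\tau_g(x)}\right)'\frac{1}{\tau_g(x)},\qquad t(x)=\int\tau_g(x)\,dx.$$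
   Context: The Galilean space $G^3$ is $\mathbb R^3$ with the scalar product $\mathbf v\cdot_G\mathbf w=v_1w_1$ if $v_1\ne0$ or $w_1\neq 0$, and $\mathbf v\cdot_G\mathbf w=v_2w_2+v_3w_3$ if $v_1=w_1=0$; the norm is $\|\mathbf v\|_G=\sqrt{|\mathbf v\cdot_G\mathbf v|}$ and the cross product is $\mathbf v\times_G\mathbf w=(0,\,v_3w_1-v_1w_3,\,v_1w_2-v_2w_1)$. A unit-speed curve (parametrized by arc length) is one of the form $\beta(x)=(x,y(x),z(x))$, $x\in I\subset\mathbb R$. Its Darboux frame with respect to $M$ is $\{\mathbf T,\mathbf Q,\mathbf n\}$ with $\mathbf T=\beta'$, $\mathbf n$ the unit normal of $M$ along $\beta$ (a vector field with first component $0$), and $\mathbf Q=\mathbf n\times_G\mathbf T$. The geodesic curvature $\kappa_g$, normal curvature $\kappa_n$ and geodesic torsion $\tau_g$ are the functions in $\mathbf T'=\kappa_g\mathbf Q+\kappa_n\mathbf n$, $\mathbf Q'=\tau_g\mathbf n$, $\mathbf n'=-\tau_g\mathbf Q$. The symbol $\int g(x)\,dx$ denotes an antiderivative of $g$. *)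

(* Defs.v *)
From Stdlib Require Export Reals.
From Coquelicot Require Export Coquelicot.
Open Scope R_scope.

(* Points and vectors of G^3 are triples ((v1, v2), v3), so that Coquelicot's
   product instances provide the topology. *)
Notation G3 := (R * R * R)%type.

Definition c1st (v : G3) : R := fst (fst v).
Definition c2nd (v : G3) : R := snd (fst v).
Definition c3rd (v : G3) : R := snd v.

Definition vadd (v w : G3) : G3 :=
  (c1st v + c1st w, c2nd v + c2nd w, c3rd v + c3rd w).
Definition vscal (a : R) (v : G3) : G3 :=
  (a * c1st v, a * c2nd v, a * c3rd v).
Definition vzero : G3 := (0, 0, 0).

Definition gdot (v w : G3) : R :=
  if Req_dec_T (c1st v) 0 then
    if Req_dec_T (c1st w) 0 then c2nd v * c2nd w + c3rd v * c3rd w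
    else c1st v * c1st w
  else c1st v * c1st w.

Definition gnorm (v : G3) : R := sqrt (Rabs (gdot v v)).

Definition gcross (v w : G3) : G3 :=
  (0, c3rd v * c1st w - c1st v * c3rd w, c1st v * c2nd w - c2nd v * c1st w).

Definition is_open_interval (I : R -> Prop) : Prop :=
  open I /\ forall a b x, I a -> I b -> a <= x <= b -> I x.

Definition smooth_fun (I : R -> Prop) (g : R -> R) : Prop :=
  forall (k : nat) (x : R), I x -> ex_derive_n g k x.

Definition smooth_curve (I : R -> Prop) (c : R -> G3) : Prop :=
  smooth_fun I (fun x => c1st (c x)) /\
  smooth_fun I (fun x => c2nd (c x)) /\
  smooth_fun I (fun x => c3rd (c x)).

Definition vDerive (c : R -> G3) (x : R) : G3 :=
  (Derive (fun s => c1st (c s)) x,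
   Derive (fun s => c2nd (c s)) x,
   Derive (fun s => c3rd (c s)) x).

Definition is_antiderivative (I : R -> Prop) (g G : R -> R) : Prop :=
  forall x, I x -> is_derive G x (g x).

(* [ex_diff_n g k] at every point of an open set says that g is C^k there. *)
Definition smooth_fun2 (U : R * R -> Prop) (g : R -> R -> R) : Prop :=
  forall (k : nat) (u v : R), U (u, v) -> ex_diff_n g k u v.

Definition smooth_map2 (U : R * R -> Prop) (X : R * R -> G3) : Prop :=
  smooth_fun2 U (fun u v => c1st (X (u, v))) /\
  smooth_fun2 U (fun u v => c2nd (X (u, v))) /\
  smooth_fun2 U (fun u v => c3rd (X (u, v))).

Definition partial_u (X : R * R -> G3) (u v : R) : G3 :=
  vDerive (fun s => X (s, v)) u.
Definition partial_v (X : R * R -> G3) (u v : R) : G3 :=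
  vDerive (fun s => X (u, s)) v.

(* X is a smooth immersion of the open set U and a homeomorphism, with inverse
   Y, onto the part of M in the open set V. *)
Definition local_parametrization (M V : G3 -> Prop) (U : R * R -> Prop)
    (X : R * R -> G3) (Y : G3 -> R * R) : Prop :=
  open V /\ open U /\ smooth_map2 U X /\
  (forall p, U p -> V (X p) /\ M (X p) /\ Y (X p) = p) /\
  (forall q, V q -> M q ->
     U (Y q) /\ X (Y q) = q /\
     filterlim Y (within M (locally q)) (locally (Y q))) /\
  (forall u v a b, U (u, v) ->
     vadd (vscal a (partial_u X u v)) (vscal b (partial_v X u v)) = vzero ->
     a = 0 /\ b = 0).

Definition regular_surface (M : G3 -> Prop) : Prop :=
  forall p, M p -> exists V U X Y, V p /\ local_parametrization M V U X Y.

Definition tangent_vector (M : G3 -> Prop) (p w : G3) : Prop :=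
  exists (eps : R) (c : R -> G3),
    0 < eps /\
    smooth_curve (fun s => - eps < s < eps) c /\
    (forall s, - eps < s < eps -> M (c s)) /\
    c 0 = p /\ vDerive c 0 = w.

Definition unit_speed_curve (I : R -> Prop) (beta : R -> G3) : Prop :=
  smooth_curve I beta /\ forall x, I x -> c1st (beta x) = x.

(* One of the two smooth choices of the unit normal; orthogonality is meant
   with respect to the Galilean scalar product. *)
Definition unit_normal_along (M : G3 -> Prop) (I : R -> Prop)
    (beta n : R -> G3) : Prop :=
  smooth_curve I n /\
  forall x, I x ->
    c1st (n x) = 0 /\ gnorm (n x) = 1 /\
    forall w, tangent_vector M (beta x) w -> gdot (n x) w = 0.

Definition frameT (beta : R -> G3) : R -> G3 := vDerive beta.
Definition frameQ (beta n : R -> G3) : R -> G3 :=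
  fun x => gcross (n x) (frameT beta x).

Definition darboux_curvatures (I : R -> Prop) (beta n : R -> G3)
    (kg kn tg : R -> R) : Prop :=
  forall x, I x ->
    vDerive (frameT beta) x
      = vadd (vscal (kg x) (frameQ beta n x)) (vscal (kn x) (n x)) /\
    vDerive (frameQ beta n) x = vscal (tg x) (n x) /\
    vDerive n x = vscal (- tg x) (frameQ beta n x).

(* Main.v *)
Require Import Defs.
From Stdlib Require Import Classical Lra.

(** Since the first coordinates of [n] and [Q] vanish, comparing first
    coordinates forces [c1 = 0].  In the Euclidean plane spanned by [Q] and [n],
    write [beta - x T = l2 Q + l3 n].  Differentiating and using the Darboux
    equations gives [l2' = tg l3 - x kg] and [l3' = - tg l2 - x kn]; with
    [mu = l2 + x kn / tg] this becomes [mu' = tg (l3 - f)], [l3' = - tg mu],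
    a forced rotation which is solved by variation of constants. *)

(** * Constants of integration and the forced rotation *)

Lemma antiderivative_zero_const (I : R -> Prop) (G : R -> R) :
  is_open_interval I -> is_antiderivative I (fun _ => 0) G ->
  exists c, forall x, I x -> G x = c.
Proof.
intros [_ Hconv] HG.
(* The constant is the value at a base point, and [I] may be empty. *)
destruct (classic (exists x0, I x0)) as [[x0 Hx0]|Hempty].
- assert (Hlt : forall a b, I a -> I b -> a < b -> G a = G b).
  { intros a b Ha Hb Hab; apply (@eq_is_derive R_NormedModule); [|exact Hab].
    intros u Hu; apply HG, (Hconv a b); assumption. }
  exists (G x0); intros x Hx.
  destruct (Rtotal_order x x0) as [H|[->|H]].
  + now apply Hlt.
  + reflexivity.
  + now symmetry; apply Hlt.
- exists 0; intros x Hx; exfalso; apply Hempty; now exists x.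
Qed.

(* [auto_derive] leaves its derivatives eta-expanded, which blocks rewriting
   with [is_derive_unique]. *)
Lemma Derive_eta_unique (g : R -> R) (x l : R) :
  is_derive g x l -> Derive (fun s : R => g s) x = l.
Proof. exact (is_derive_unique g x l). Qed.

(** Rotating [(mu, l3)] by the angle [t] cancels the homogeneous part: [mu sin t + l3 cos t] has
    derivative [- f tg sin t], and [l3 sin t - mu cos t] has derivative [f tg cos t]. Adding [Fs] to
    the first and subtracting [Fc] from the second gives the constants [c2] and [c3]; the inverse
    rotation recovers [mu] and [l3]. *)
Lemma forced_rotation_solution (I : R -> Prop) (tg f mu l3 t Fs Fc : R -> R) :
  is_open_interval I ->
  is_antiderivative I (fun x => tg x * (l3 x - f x)) mu ->
  is_antiderivative I (fun x => - tg x * mu x) l3 ->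
  is_antiderivative I tg t ->
  is_antiderivative I (fun x => f x * tg x * sin (t x)) Fs ->
  is_antiderivative I (fun x => f x * tg x * cos (t x)) Fc ->
  exists c2 c3 : R, forall x, I x ->
    mu x = (c2 - Fs x) * sin (t x) - (c3 + Fc x) * cos (t x) /\
    l3 x = (c2 - Fs x) * cos (t x) + (c3 + Fc x) * sin (t x).
Proof.
intros HI Hmu Hl3 Ht HFs HFc.
destruct (antiderivative_zero_const I
  (fun x => mu x * sin (t x) + l3 x * cos (t x) + Fs x) HI) as [c2 Hc2].
{ intros x Hx.
  specialize (Hmu x Hx); specialize (Hl3 x Hx); specialize (Ht x Hx).
  specialize (HFs x Hx).
  auto_derive.
  - repeat split; eexists; eassumption.
  - rewrite (Derive_eta_unique mu x _ Hmu),
      (Derive_eta_unique l3 x _ Hl3),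
      (Derive_eta_unique t x _ Ht),
      (Derive_eta_unique Fs x _ HFs); ring. }
destruct (antiderivative_zero_const I
  (fun x => l3 x * sin (t x) - mu x * cos (t x) - Fc x) HI) as [c3 Hc3].
{ intros x Hx.
  specialize (Hmu x Hx); specialize (Hl3 x Hx); specialize (Ht x Hx).
  specialize (HFc x Hx).
  auto_derive.
  - repeat split; eexists; eassumption.
  - rewrite (Derive_eta_unique mu x _ Hmu),
      (Derive_eta_unique l3 x _ Hl3),
      (Derive_eta_unique t x _ Ht),
      (Derive_eta_unique Fc x _ HFc); ring. }
exists c2, c3; intros x Hx.
rewrite <- (Hc2 x Hx), <- (Hc3 x Hx).
pose proof (sin2_cos2 (t x)) as Hsc; unfold Rsqr in Hsc.
split.
- transitivity (mu x * (sin (t x) * sin (t x) + cos (t x) * cos (t x)));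
    [rewrite Hsc|]; ring.
- transitivity (l3 x * (sin (t x) * sin (t x) + cos (t x) * cos (t x)));
    [rewrite Hsc|]; ring.
Qed.

Lemma gnorm_unit_sum_squares (v : G3) :
  c1st v = 0 -> gnorm v = 1 -> c2nd v * c2nd v + c3rd v * c3rd v = 1.
Proof.
unfold gnorm, gdot; intros Hv Hnorm.
destruct (Req_dec_T (c1st v) 0) as [_|H]; [|contradiction].
rewrite Rabs_pos_eq in Hnorm by nra.
rewrite <- (sqrt_sqrt (c2nd v * c2nd v + c3rd v * c3rd v)) by nra.
rewrite Hnorm; ring.
Qed.

(** * The Darboux frame and the position vector in coordinates *)

Section DarbouxFrame.

Variables (I : R -> Prop) (beta n : R -> G3) (kg kn tg : R -> R).
Hypothesis HI : is_open_interval I.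
Hypothesis Hbeta : unit_speed_curve I beta.
Hypothesis Hsmooth_n : smooth_curve I n.
Hypothesis Hunit : forall x, I x -> c1st (n x) = 0 /\ gnorm (n x) = 1.
Hypothesis Hcurv : darboux_curvatures I beta n kg kn tg.

Let y x := c2nd (beta x).
Let z x := c3rd (beta x).
Let n2 x := c2nd (n x).
Let n3 x := c3rd (n x).

Lemma locally_interval x : I x -> locally x I.
Proof. intros Hx; exact (proj1 HI x Hx). Qed.

Lemma frameT_unit_speed x : I x -> frameT beta x = (1, Derive y x, Derive z x).
Proof.
intros Hx; unfold frameT, vDerive; do 2 f_equal.
(* The first coordinate of [beta] is the identity only on [I]; openness of [I] makes this enough for
   the derivative. *)
rewrite <- (Derive_id x); apply Derive_ext_loc.
apply (filter_imp I); [exact (proj2 Hbeta)|now apply locally_interval].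
Qed.

Lemma frameQ_unit_speed x : I x -> frameQ beta n x = (0, n3 x, - n2 x).
Proof.
intros Hx; unfold frameQ; rewrite (frameT_unit_speed x Hx).
unfold gcross; rewrite (proj1 (Hunit x Hx)); cbn.
unfold n2, n3; f_equal; [f_equal|]; ring.
Qed.

Lemma normal_sum_squares x : I x -> n2 x * n2 x + n3 x * n3 x = 1.
Proof.
intros Hx; destruct (Hunit x Hx) as [H1 H2].
now apply gnorm_unit_sum_squares.
Qed.

Lemma is_derive_normal x : I x ->
  is_derive n2 x (- tg x * n3 x) /\ is_derive n3 x (tg x * n2 x).
Proof.
intros Hx; destruct Hsmooth_n as [_ [Hs2 Hs3]].
destruct (Hcurv x Hx) as [_ [_ Hn']].
rewrite (frameQ_unit_speed x Hx) in Hn'; unfold vDerive, vscal in Hn'; cbn in Hn'.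
injection Hn' as _ H2 H3.
split.
(* [Derive] is total, so the Darboux equations alone do not give differentiability; smoothness of
   [n] at order 1 does. *)
- rewrite <- H2; apply Derive_correct, (Hs2 1%nat x Hx).
- replace (tg x * n2 x) with (- tg x * - n2 x) by ring.
  rewrite <- H3; apply Derive_correct, (Hs3 1%nat x Hx).
Qed.

Lemma is_derive_position x : I x ->
  is_derive y x (Derive y x) /\ is_derive z x (Derive z x).
Proof.
intros Hx; destruct Hbeta as [[_ [Hs2 Hs3]] _].
split; apply Derive_correct; [apply (Hs2 1%nat x Hx)|apply (Hs3 1%nat x Hx)].
Qed.

Lemma is_derive_tangent x : I x ->
  is_derive (Derive y) x (kg x * n3 x + kn x * n2 x) /\
  is_derive (Derive z) x (- kg x * n2 x + kn x * n3 x).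
Proof.
intros Hx; destruct Hbeta as [[_ [Hs2 Hs3]] _].
destruct (Hcurv x Hx) as [HT' _].
rewrite (frameQ_unit_speed x Hx) in HT'.
unfold vDerive at 1, vadd, vscal in HT'; cbn in HT'.
injection HT' as _ H2 H3.
change (Derive (Derive y) x = kg x * n3 x + kn x * n2 x) in H2.
change (Derive (Derive z) x = kg x * - n2 x + kn x * n3 x) in H3.
split.
- rewrite <- H2; apply Derive_correct, (Hs2 2%nat x Hx).
- replace (- kg x * n2 x) with (kg x * - n2 x) by ring.
  rewrite <- H3; apply Derive_correct, (Hs3 2%nat x Hx).
Qed.

(* [kn = T' . n] on [I], and [T'], [n] are smooth. *)
Lemma ex_derive_normal_curvature x : I x -> ex_derive kn x.
Proof.
intros Hx.
apply (ex_derive_ext_loc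
  (fun s => Derive (Derive y) s * n2 s + Derive (Derive z) s * n3 s)).
- apply (filter_imp I); [|now apply locally_interval].
  intros s Hs; destruct (is_derive_tangent s Hs) as [H2 H3].
  rewrite (is_derive_unique _ _ _ H2), (is_derive_unique _ _ _ H3).
  simpl; transitivity (kn s * (n2 s * n2 s + n3 s * n3 s)); [ring|].
  rewrite (normal_sum_squares s Hs); ring.
- destruct Hbeta as [[_ [Hs2 Hs3]] _].
  destruct (is_derive_normal x Hx) as [H2 H3].
  apply @ex_derive_plus; apply ex_derive_mult.
  + exact (Hs2 3%nat x Hx).
  + now eexists; apply H2.
  + exact (Hs3 3%nat x Hx).
  + now eexists; apply H3.
Qed.

(* [tg = Q' . n] on [I] with [Q = (0, n3, - n2)]. *)
Lemma ex_derive_geodesic_torsion x : I x -> ex_derive tg x.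
Proof.
intros Hx.
apply (ex_derive_ext_loc (fun s => Derive n3 s * n2 s - Derive n2 s * n3 s)).
- apply (filter_imp I); [|now apply locally_interval].
  intros s Hs; destruct (is_derive_normal s Hs) as [H2 H3].
  rewrite (is_derive_unique _ _ _ H2), (is_derive_unique _ _ _ H3).
  simpl; transitivity (tg s * (n2 s * n2 s + n3 s * n3 s)); [ring|].
  rewrite (normal_sum_squares s Hs); ring.
- destruct Hsmooth_n as [_ [Hs2 Hs3]].
  destruct (is_derive_normal x Hx) as [H2 H3].
  apply @ex_derive_minus; apply ex_derive_mult.
  + exact (Hs3 2%nat x Hx).
  + now eexists; apply H2.
  + exact (Hs2 2%nat x Hx).
  + now eexists; apply H3.
Qed.

(** The Euclidean products of [beta - x T] with [Q = (0, n3, - n2)] and with [n], that is, [l2] and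
    [l3] of the plan. *)
Definition coordQ x :=
  (y x - x * Derive y x) * n3 x - (z x - x * Derive z x) * n2 x.
Definition coordn x :=
  (y x - x * Derive y x) * n2 x + (z x - x * Derive z x) * n3 x.

(** [T] has first coordinate 1, so [beta - x T] lies in the plane of vectors with first coordinate
    0, where [Q] and [n] form an orthonormal basis. *)
Lemma position_decomposition x : I x ->
  beta x = vadd (vadd (vscal x (frameT beta x))
                      (vscal (coordQ x) (frameQ beta n x)))
                (vscal (coordn x) (n x)).
Proof.
intros Hx; rewrite (frameT_unit_speed x Hx), (frameQ_unit_speed x Hx).
pose proof (normal_sum_squares x Hx) as Hsq.
pose proof (proj2 Hbeta x Hx) as H1.
pose proof (proj1 (Hunit x Hx)) as Hn1.
rewrite (surjective_pairing (beta x)), (surjective_pairing (fst (beta x))).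
unfold vadd, vscal, coordQ, coordn; cbn.
change (c1st (n x)) with (fst (fst (n x))).
unfold c1st in H1, Hn1; rewrite H1, Hn1.
change (snd (fst (beta x))) with (y x); change (snd (beta x)) with (z x).
change (c2nd (n x)) with (n2 x); change (c3rd (n x)) with (n3 x).
set (a := Derive y x); set (b := Derive z x).
f_equal; [f_equal|].
- ring.
- transitivity (x * a + (y x - x * a) * (n2 x * n2 x + n3 x * n3 x));
    [rewrite Hsq|]; ring.
- transitivity (x * b + (z x - x * b) * (n2 x * n2 x + n3 x * n3 x));
    [rewrite Hsq|]; ring.
Qed.

(** Since [(beta - x T)' = - x T'], the curvatures enter only through [- x kg] and [- x kn]; the
    [tg] terms come from the rotation of [Q] and [n]. *)
Lemma is_derive_coords x : I x ->
  is_derive coordQ x (tg x * coordn x - x * kg x) /\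
  is_derive coordn x (- tg x * coordQ x - x * kn x).
Proof.
intros Hx.
destruct (is_derive_normal x Hx) as [H2 H3].
destruct (is_derive_position x Hx) as [Hy Hz].
destruct (is_derive_tangent x Hx) as [Hy' Hz'].
pose proof (normal_sum_squares x Hx) as Hsq.
unfold coordQ, coordn; clearbody y z n2 n3.
(* With [y'] and [z'] made opaque, [auto_derive] treats them as atoms whose derivatives are given by
   [Hy'] and [Hz']. *)
pose (a := Derive y); pose (b := Derive z).
fold a in Hy, Hy' |- *; fold b in Hz, Hz' |- *.
clearbody a b.
split; auto_derive.
1, 3: repeat split; eexists; eassumption.
all: rewrite (Derive_eta_unique y x _ Hy),
       (Derive_eta_unique z x _ Hz),
       (Derive_eta_unique a x _ Hy'),
       (Derive_eta_unique b x _ Hz'),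
       (Derive_eta_unique n2 x _ H2),
       (Derive_eta_unique n3 x _ H3).
(* Inserting the squared length of [n], which is 1, turns the goal into a polynomial identity. *)
- replace (x * kg x) with (x * kg x * (n2 x * n2 x + n3 x * n3 x))
    by (rewrite Hsq; ring).
  ring.
- replace (x * kn x) with (x * kn x * (n2 x * n2 x + n3 x * n3 x))
    by (rewrite Hsq; ring).
  ring.
Qed.

End DarbouxFrame.

Theorem theorem3p1 (M : G3 -> Prop) (I : R -> Prop) (beta n : R -> G3)
  (kg kn tg : R -> R)
  (HM : regular_surface M)
  (HI : is_open_interval I)
  (Hbeta : unit_speed_curve I beta)
  (HbetaM : forall x, I x -> M (beta x))
  (Hn : unit_normal_along M I beta n)
  (Hcurv : darboux_curvatures I beta n kg kn tg)
  (Htg : forall x, I x -> tg x <> 0) :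
  exists c1 : R,
    let lambda1 := fun x => x + c1 in
    let f := fun x =>
      lambda1 x * kg x / tg x
      - Derive (fun s => lambda1 s * kn s / tg s) x * (1 / tg x) in
    forall t : R -> R, is_antiderivative I tg t ->
    forall Fs Fc : R -> R,
      is_antiderivative I (fun x => f x * tg x * sin (t x)) Fs ->
      is_antiderivative I (fun x => f x * tg x * cos (t x)) Fc ->
      exists c2 c3 : R, forall x, I x ->
        beta x =
          vadd (vadd
            (vscal (x + c1) (frameT beta x))
            (vscal (- ((x + c1) * kn x / tg x)
                    + (c2 - Fs x) * sin (t x)
                    - (c3 + Fc x) * cos (t x))
                   (frameQ beta n x)))
            (vscal ((c2 - Fs x) * cos (t x) + (c3 + Fc x) * sin (t x))
                   (n x)).
Proof.
destruct Hn as [Hsn Hn'].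
assert (Hunit : forall x, I x -> c1st (n x) = 0 /\ gnorm (n x) = 1).
{ intros x Hx; destruct (Hn' x Hx) as [H1 [H2 _]]; now split. }
exists 0; intros lambda1 f t Ht Fs Fc HFs HFc.
(* Shifting by [q] absorbs the [kn] term of [coordn']; the price is [q'] in the other equation,
   hence the derivative in [f]. *)
pose (q := fun s => lambda1 s * kn s / tg s).
pose (mu := fun x => coordQ beta n x + q x).
assert (Hmu : is_antiderivative I (fun x => tg x * (coordn beta n x - f x)) mu).
{ intros x Hx.
  destruct (is_derive_coords I beta n kg kn tg HI Hbeta Hsn Hunit Hcurv x Hx)
    as [HQ _].
  (* Differentiability of [kn] and [tg] is inherited from [beta] and [n], so the [Derive] inside [f]
     is a genuine derivative. *)
  assert (Hq : ex_derive q x).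
  { apply ex_derive_div; [apply ex_derive_mult| |now apply Htg].
    - unfold lambda1; now auto_derive.
    - now apply (ex_derive_normal_curvature I beta n kg kn tg).
    - now apply (ex_derive_geodesic_torsion I beta n kg kn tg). }
  (* Here [tg f = lambda1 kg - q'], so adding [q'] to [coordQ'] leaves exactly this product. *)
  replace (tg x * (coordn beta n x - f x))
    with (plus (tg x * coordn beta n x - x * kg x) (Derive q x)).
  - apply @is_derive_plus; [exact HQ|now apply Derive_correct].
  - unfold f; fold q; unfold lambda1, plus; cbn; field; now apply Htg. }
assert (Hl3 : is_antiderivative I (fun x => - tg x * mu x) (coordn beta n)).
{ intros x Hx.
  destruct (is_derive_coords I beta n kg kn tg HI Hbeta Hsn Hunit Hcurv x Hx)
    as [_ H3].
  replace (- tg x * mu x) with (- tg x * coordQ beta n x - x * kn x);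
    [exact H3|].
  unfold mu, q, lambda1; field; now apply Htg. }
destruct (forced_rotation_solution I tg f mu (coordn beta n) t Fs Fc
            HI Hmu Hl3 Ht HFs HFc) as [c2 [c3 Hsol]].
exists c2, c3; intros x Hx; destruct (Hsol x Hx) as [Hmux Hl3x].
rewrite (position_decomposition I beta n HI Hbeta Hunit x Hx) at 1.
rewrite <- Hl3x.
replace (- ((x + 0) * kn x / tg x) + (c2 - Fs x) * sin (t x)
         - (c3 + Fc x) * cos (t x)) with (coordQ beta n x).
- now rewrite Rplus_0_r.
- assert (E : coordQ beta n x = mu x - q x) by (unfold mu; ring).
  rewrite E, Hmux; unfold q, lambda1; ring.
Qed.
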